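(* Let $d\ge 2$, $m>0$, and let $K:\mathbb{R}^d\to\mathbb{R}\cup\{+\infty\}$ be a radially symmetric kernel that is locally integrable, nonnegative, lower semicontinuous, and satisfies $\lim_{|x|\to\infty}K(x)=\infty$. Then a measurable set $\Omega\subset\mathbb{R}^d$ with $|\Omega|=m$ is a solution of problem (P) if and only if its characteristic function $\chi_\Omega$ is a solution of problem (RP), where (P): minimize $\int_\Omega\int_\Omega K(x-y)\,dx\,dy$ over measurable sets $\Omega\subset\mathbb{R}^d$ with $|\Omega|=m$; (RP): minimize $\mathsf{E}(\rho)=\int_{\mathbb{R}^d}\int_{\mathbb{R}^d}K(x-y)\rho(x)\rho(y)\,dx\,dy$ over $\rho\in\mathcal{A}_{m,1}$.
   Context: $\mathcal{A}_{m,1}:=\{\rho\in L^1(\mathbb{R}^d)\cap L^\infty(\mathbb{R}^d):\ \|\rho\|_{L^1(\mathbb{R}^d)}=m,\ 0\le\rho(x)\le 1\text{ a.e.}\}$. $|\Omega|$ denotes Lebesgue measure. A ''solution'' of either problem means an admissible element attaining the infimum (a global minimizer). *)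

(* Defs.v *)
From HB Require Import structures.
From mathcomp Require Import all_boot all_order all_algebra.
From mathcomp Require Import all_classical all_reals all_analysis.

Set Implicit Arguments.
Unset Strict Implicit.
Unset Printing Implicit Defensive.
Import Order.TTheory GRing.Theory Num.Theory.
Import numFieldNormedType.Exports.

Local Open Scope classical_set_scope.
Local Open Scope ring_scope.
Local Open Scope ereal_scope.

Section lebesgue_rV.
Context (R : realType) (d : nat).

Definition box (ab : 'rV[R]_d * 'rV[R]_d) : set 'rV[R]_d :=
  [set x | forall i, (ab.1 ord0 i < x ord0 i <= ab.2 ord0 i)%R].

Definition box_volume (ab : 'rV[R]_d * 'rV[R]_d) : \bar R :=
  (\prod_i Num.max 0 (ab.2 ord0 i - ab.1 ord0 i))%R%:E.

(* The covers are at most countable, possibly finite or empty: the index set is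
   needed for d = 0, where the only box is the whole space and has volume 1. *)
Definition box_cover (A : set 'rV[R]_d)
    (c : set nat * (nat -> 'rV[R]_d * 'rV[R]_d)) : Prop :=
  A `<=` \bigcup_(k in c.1) box (c.2 k).

Definition lebesgue_outer (A : set 'rV[R]_d) : \bar R :=
  ereal_inf [set \esum_(k in c.1) box_volume (c.2 k) | c in box_cover A].

Lemma box_volume_ge0 ab : 0 <= box_volume ab.
Proof. by rewrite lee_fin; apply: prodr_ge0 => i _; rewrite le_max lexx. Qed.

Lemma lebesgue_outer_ge0 A : 0 <= lebesgue_outer A.
Proof.
apply: le_ereal_inf_tmp => _ [c _ <-].
by apply: esum_ge0 => k _; exact: box_volume_ge0.
Qed.

Lemma lebesgue_outer0 : lebesgue_outer set0 = 0.
Proof.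
apply/eqP; rewrite eq_le lebesgue_outer_ge0 andbT.
apply: ereal_inf_lbound; exists (set0, fun=> (0, 0)%R); last by rewrite esum_set0.
by move=> x.
Qed.

Lemma le_lebesgue_outer :
  {homo lebesgue_outer : A B / A `<=` B >-> A <= B}.
Proof.
move=> A B AB; apply: ereal_inf_le_tmp => _ [c Bc <-].
by exists c => //; exact: subset_trans AB Bc.
Qed.

Lemma lebesgue_outer_sigma_subadditive : sigma_subadditive lebesgue_outer.
Proof.
move=> A; have [[i ioo]|] := pselect (exists i, lebesgue_outer (A i) = +oo).
  rewrite (eseries_pinfty _ _ ioo) ?leey// => n _.
  by rewrite -ltNye (lt_le_trans _ (lebesgue_outer_ge0 _)).
rewrite -forallNE => Aoo; apply/lee_addgt0Pr => _/posnumP[e].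
rewrite (le_trans _ (epsilon_trick _ _ _))//; last first.
  by move=> n; exact: lebesgue_outer_ge0.
pose P n c := box_cover (A n) c /\
  \esum_(k in c.1) box_volume (c.2 k) <=
    lebesgue_outer (A n) + (e%:num / (2 ^ n.+1)%:R)%:E.
have [c Pc] : {c & forall n, P n (c n)}.
  apply: (@choice _ _ P) => n.
  have Afin : lebesgue_outer (A n) \is a fin_num.
    by rewrite ge0_fin_numE ?lebesgue_outer_ge0// ltey; apply/eqP.
  have en0 : (0 < e%:num / (2 ^ n.+1)%:R)%R by [].
  have [_ [c Ac <-] /ltW le_c] := lb_ereal_inf_adherent en0 Afin.
  by exists c.
pose a (p : nat * nat) := box_volume ((c p.1).2 p.2).
have a0 p : 0 <= a p by exact: box_volume_ge0.
have /card_esym/ppcard_eqP[f] := card_nat2.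
pose D := [set k | (c (f k).1).1 (f k).2].
apply: (@le_trans _ _ (\esum_(k in D) a (f k))).
  apply: ereal_inf_lbound.
  exists (D, fun k => (c (f k).1).2 (f k).2) => //.
  move=> x [n _ /((Pc n).1)[j cj xj]].
  by exists (f^-1%FUN (n, j)); rewrite /D /= invK ?inE.
rewrite (_ : \esum_(k in D) a (f k) =
    \sum_(n <oo) \esum_(j in (c n).1) a (n, j)); last first.
  rewrite nneseries_esumT; last by move=> n; apply: esum_ge0 => j _; exact: a0.
  rewrite esum_esum//.
  rewrite (reindex_esum D _ f)//.
  split.
  - by move=> k Dk; split.
  - by move=> k l _ _ /inj; apply; rewrite inE.
  - move=> [n j] [_ /= cj]; exists (f^-1%FUN (n, j)); rewrite /D /= invK ?inE//.
by apply: lee_nneseries => n *; [apply: esum_ge0 => j _; exact: a0|exact: (Pc n).2].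
Qed.

HB.instance Definition _ := isOuterMeasure.Build R 'rV[R]_d lebesgue_outer
  lebesgue_outer0 lebesgue_outer_ge0 le_lebesgue_outer
  lebesgue_outer_sigma_subadditive.

End lebesgue_rV.

(* R^d with the sigma-algebra of Lebesgue (= Caratheodory) measurable sets,
   which is strictly larger than the Borel one. *)
Notation Rd R d := (caratheodory_type (@lebesgue_outer R d)).

Definition lebesgue_rV {R : realType} {d : nat} : set (Rd R d) -> \bar R :=
  @lebesgue_outer R d.
HB.instance Definition _ (R : realType) (d : nat) :=
  isMeasure.Build _ (Rd R d) R (@lebesgue_rV R d)
    (@caratheodory_measure0 _ _ (@lebesgue_outer R d))
    (@caratheodory_measure_ge0 _ _ (@lebesgue_outer R d))
    (@caratheodory_measure_sigma_additive _ _ (@lebesgue_outer R d)).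

(* The library norm on row vectors is the sup norm. *)
Definition enorm (R : realType) (d : nat) (x : 'rV[R]_d) : R :=
  Num.sqrt (\sum_i x ord0 i ^+ 2)%R.

Section kernels.
Context (R : realType) (d : nat).
Implicit Type K : 'rV[R]_d -> \bar R.

Definition radially_symmetric K :=
  forall x y, enorm x = enorm y -> K x = K y.

Definition locally_integrable_rV K :=
  forall C : set 'rV[R]_d, compact C -> (@lebesgue_rV R d).-integrable C K.

Definition tends_to_infinity K :=
  forall M : R, exists r : R, forall x, (r < enorm x)%R -> M%:E < K x.

End kernels.

Section minimization.
Context (R : realType) (d : nat).
Local Notation mu := (@lebesgue_rV R d).

Definition solution (X : Type) (adm : set X) (F : X -> \bar R) (x : X) :=
  adm x /\ F x = ereal_inf [set F y | y in adm].

Definition admissible_sets (m : R) : set (set (Rd R d)) :=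
  [set Omega | measurable Omega /\ mu Omega = m%:E].

Definition set_energy (K : 'rV[R]_d -> \bar R) (Omega : set (Rd R d)) : \bar R :=
  \int[mu]_(y in Omega) \int[mu]_(x in Omega) K (x - y)%R.

Definition admissible_densities (m : R) : set (Rd R d -> R) :=
  [set rho | [/\ rho \in Lfun mu 1, rho \in Lfun mu +oo,
                 'N[mu]_1[EFin \o rho] = m%:E &
                 {ae mu, forall x, (0 <= rho x <= 1)%R}]].

Definition energy (K : 'rV[R]_d -> \bar R) (rho : Rd R d -> R) : \bar R :=
  \int[mu]_y \int[mu]_x (K (x - y)%R * (rho x)%:E * (rho y)%:E).

End minimization.

(* Main.v *)
(** The point is that the infimum over sets is at most the energy of every
    density [rho].  Where [0 < rho < 1] only on a null set, [{rho = 1}] will do.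
    Otherwise the mass of [rho] on the region where it is small is moved to a
    region where [rho] is bounded away from 0 and 1; this costs a factor close
    to 1 in energy, and leaves a density [sigma] carried by a set [A] of finite
    measure on which [rho >= delta], so that the kernel is integrable on
    [A * A].  Such a kernel is approximated in L^1 by combinations of rectangles
    [X * Y], whose energy is a product of integrals over [X] and [Y]; the energy
    of a density on [A] is thus fixed, up to [e], by its integrals over finitely
    many test sets.  As Lebesgue measure has no atoms, some set has the same
    such integrals as [sigma]. *)
Require Import Defs.
From HB Require Import structures.
From mathcomp Require Import all_boot all_order all_algebra.
From mathcomp Require Import all_classical all_reals all_analysis.
From mathcomp Require Import measurable_realfun ess_sup_inf lra ring.
Import Order.TTheory GRing.Theory Num.Theory.
Import numFieldNormedType.Exports.
Local Open Scope classical_set_scope.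
Local Open Scope ring_scope.

(** Cutting []a, b]] at [t]. The truncations at 0 make the identity hold wherever [t] lies, and also
    when [b < a]. *)
Lemma interval_length_split {R : realDomainType} (a b t : R) :
  Num.max 0 (b - a) =
  Num.max 0 (Num.min b t - a) + Num.max 0 (b - Num.max a t).
Proof.
rewrite (minElt b) (maxElt a).
case: (ltP b t) => ?; case: (ltP a t) => ?; rewrite !maxElt;
  (repeat case: ltP => ?); lra.
Qed.

(** * Lebesgue measure on row vectors *)

Section euclidean_measure.
Context {R : realType} {d : nat}.
Local Notation mu := (@lebesgue_rV R d).
Implicit Types (ab : 'rV[R]_d * 'rV[R]_d) (i : 'I_d) (t : R).

(** As boxes are open on the left and closed on the right, the hyperplane [x_i = t] cuts a box into
    two disjoint boxes of the same kind. *)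
Definition box_below i t ab : 'rV[R]_d * 'rV[R]_d :=
  (ab.1, \row_j if j == i then Num.min (ab.2 ord0 j) t else ab.2 ord0 j).

Definition box_above i t ab : 'rV[R]_d * 'rV[R]_d :=
  (\row_j if j == i then Num.max (ab.1 ord0 j) t else ab.1 ord0 j, ab.2).

Lemma box_belowE i t ab :
  box (box_below i t ab) = box ab `&` [set x | x ord0 i <= t].
Proof.
apply/seteqP; split => x /=.
  move=> h; split.
    move=> j; have := h j; rewrite mxE; case: ifP => // _.
    by rewrite le_min => /and3P[-> -> _].
  by have := h i; rewrite mxE eqxx le_min => /and3P[].
move=> [h xt] j; rewrite mxE; case: ifPn => [/eqP ji|_]; last exact: h.
by rewrite le_min andbA h ji xt.
Qed.

Lemma box_aboveE i t ab :
  box (box_above i t ab) = box ab `&` ~` [set x | x ord0 i <= t].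
Proof.
apply/seteqP; split => x /=.
  move=> h; split.
    move=> j; have := h j; rewrite mxE; case: ifP => // _.
    by rewrite gt_max => /andP[/andP[-> _] ->].
  have := h i; rewrite mxE eqxx gt_max => /andP[/andP[_ +] _].
  by rewrite ltNge => /negP.
move=> [h /negP]; rewrite -ltNge => xt j; rewrite mxE.
case: ifPn => [/eqP ji|_]; last exact: h.
by rewrite gt_max ji xt andbT -ji h.
Qed.

Lemma box_volume_split i t ab :
  (box_volume ab =
   box_volume (box_below i t ab) + box_volume (box_above i t ab))%E.
Proof.
rewrite /box_volume -EFinD !(bigD1 i (P := predT))//=; congr EFin.
rewrite !mxE eqxx.
under [X in _ = _ * X + _]eq_bigr => j ji do rewrite mxE (negbTE ji).
under [X in _ = _ + _ * X]eq_bigr => j ji do rewrite mxE (negbTE ji).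
rewrite -mulrDl; congr (_ * _).
exact: interval_length_split.
Qed.

(** Caratheodory's criterion: cutting every box of a cover of [X] along the hyperplane gives covers
    of the two parts of [X], and the volumes of the pieces add up to the original ones. *)
Lemma measurable_halfspace i t :
  measurable ([set x | x ord0 i <= t] : set (Rd R d)).
Proof.
apply: le_caratheodory_measurable => X.
apply: le_ereal_inf_tmp => _ [c Xc <-].
under eq_esum do rewrite (box_volume_split i t).
rewrite esumD; [|by move=> *; exact: box_volume_ge0..].
apply: leeD; apply: ereal_inf_lbound.
- exists (c.1, box_below i t \o c.2) => // x [Xx xt].
  by have [k ck ckx] := Xc _ Xx; exists k => //=; rewrite box_belowE.
- exists (c.1, box_above i t \o c.2) => // x [Xx xt].
  by have [k ck ckx] := Xc _ Xx; exists k => //=; rewrite box_aboveE.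
Qed.

Lemma measurable_coord i : measurable_fun setT (fun x : Rd R d => x ord0 i).
Proof.
apply: (measurability (@RGenOInfty.G R) (RGenOInfty.measurableE R)).
move=> _ [_ [t ->] <-]; rewrite setTI.
rewrite (_ : _ @^-1` _ = ~` [set x : 'rV[R]_d | x ord0 i <= t]); last first.
  by apply/seteqP; split => x /=; rewrite in_itv/= andbT ltNge => /negP.
exact/measurableC/measurable_halfspace.
Qed.

Lemma measurable_box ab : measurable (box ab : set (Rd R d)).
Proof.
rewrite (_ : box ab = \bigcap_(i in [set: 'I_d])
    ((fun x : Rd R d => x ord0 i) @^-1` `]ab.1 ord0 i, ab.2 ord0 i])).
  apply: fin_bigcap_measurable => // i _.
  by rewrite -[X in measurable X]setTI; exact: measurable_coord.
apply/seteqP; split=> x /= h i.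
  by rewrite /= in_itv/= h.
by have := h i Logic.I; rewrite /= in_itv.
Qed.

Lemma lebesgue_rV_box_le ab : (mu (box ab) <= box_volume ab)%E.
Proof.
apply: ereal_inf_lbound; exists ([set 0%N], fun=> ab); first by exists 0%N.
by rewrite esum_set1// box_volume_ge0.
Qed.

Definition cube (n : nat) : set (Rd R d) :=
  box (const_mx (- n%:R), const_mx n%:R).

Lemma cube_nondecreasing (m n : nat) : (m <= n)%N -> cube m `<=` cube n.
Proof.
move=> mn x /= h i; have := h i; rewrite !mxE => /andP[lx xl].
by rewrite (le_lt_trans _ lx) ?lerN2 ?ler_nat// (le_trans xl) ?ler_nat.
Qed.

Lemma bigcup_cube : \bigcup_n cube n = setT.
Proof.
apply/seteqP; split=> // x _.
pose r := \sum_i `|x ord0 i|.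
exists (Num.trunc r).+1 => //= i; rewrite !mxE.
have ri : `|x ord0 i| <= r.
  by rewrite /r (bigD1 i)//= lerDl sumr_ge0.
have rn : r < (Num.trunc r).+1%:R by rewrite truncnS_gt.
have /andP[h1 /ltW h2] : - (Num.trunc r).+1%:R < x ord0 i < (Num.trunc r).+1%:R.
  by rewrite -ltr_norml (le_lt_trans ri).
by rewrite h1.
Qed.

Lemma sigma_finite_lebesgue_rV : sigma_finite setT mu.
Proof.
exists cube; first by rewrite bigcup_cube.
move=> n; split; first exact: measurable_box.
by rewrite (le_lt_trans (lebesgue_rV_box_le _))// ltry.
Qed.

HB.instance Definition _ :=
  Measure_isSigmaFinite.Build _ _ _ mu sigma_finite_lebesgue_rV.

(** The product sigma-algebra is tied to the topology only through coordinates, so [U] is exhausted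
    by countably many cubes, each of which pulls back to finitely many conditions on the differences
    [z.1 i - z.2 i]. *)
Lemma measurable_open_sub (U : set 'rV[R]_d) : open U ->
  measurable [set z : Rd R d * Rd R d | U (z.1 - z.2)].
Proof.
move=> oU.
(* Rational cubes form a countable base of the topology. *)
pose near (p : 'rV[rat]_d * nat) (x : 'rV[R]_d) :=
  forall i, `|x ord0 i - ratr (p.1 ord0 i)| < p.2.+1%:R^-1.
pose F p : set (Rd R d * Rd R d) :=
  [set z | (near p `<=` U) /\ near p (z.1 - z.2)].
rewrite (_ : mkset _ = \bigcup_p F p); last first.
  apply/seteqP; split => [[x y] /= Uxy|[x y] [p _ [pU /pU]]//].
  have [e /= e0 eU] : exists2 e : R, 0 < e & ball (x - y) e `<=` U.
    by have /nbhs_ballP[e] := oU _ Uxy; exists e.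
  (* Two errors below [1 / (n + 1)], from [x - y] to the rational centre and from there to [z], must
     add up to less than [e]. *)
  pose n := Num.trunc (2 / e).
  have ne : n.+1%:R^-1 < e / 2.
    rewrite invf_plt ?posrE ?divr_gt0// invf_div.
    exact: truncnS_gt.
  have n0 : 0 < n.+1%:R^-1 :> R by rewrite invr_gt0.
  have lt_pm (u v : R) : 0 < v -> u - v < u + v by move=> ?; lra.
  have /choice[q qP] : forall i, exists q : rat,
      ratr q \in `](x - y) ord0 i - n.+1%:R^-1, (x - y) ord0 i + n.+1%:R^-1[.
    by move=> i; apply: rat_in_itvoo; apply: lt_pm.
  exists (\row_i q i, n) => //; split => /=; last first.
    move=> i; rewrite [in ratr _]mxE distrC ltr_distl.
    by have := qP i; rewrite in_itv.
  move=> z zq; apply: eU; split => // i j; rewrite (ord1 i).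
  have zj : `|ratr (q j) - z ord0 j| < n.+1%:R^-1.
    by have := zq j; rewrite /= [in ratr _]mxE distrC.
  have xj : `|(x - y) ord0 j - ratr (q j)| < n.+1%:R^-1.
    by have := qP j; rewrite in_itv/= -ltr_distl distrC.
  rewrite /ball/= (le_lt_trans (ler_distD (ratr (q j)) _ _))//.
  by rewrite (splitr e) ltrD// (lt_trans _ ne).
apply: countable_bigcupT_measurable => [|p]; first exact: countableP.
(* The inclusion in [U] does not involve [z], so [F p] is either empty or the full preimage of the
   cube. *)
have [pU|npU] := pselect (near p `<=` U); last first.
  by rewrite (_ : F p = set0)//; apply/seteqP; split => // z [].
rewrite (_ : F p = \bigcap_(i in [set: 'I_d])
    ((fun z : Rd R d * Rd R d => z.1 ord0 i - z.2 ord0 i) @^-1`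
      [set t | `|t - ratr (p.1 ord0 i)| < p.2.+1%:R^-1])); last first.
  apply/seteqP; split => z /=.
    by move=> [_ zp] i _; have := zp i; rewrite !mxE.
  by move=> h; split => // i; rewrite !mxE; exact: h.
apply: fin_bigcap_measurable => // i _.
rewrite -[X in measurable X]setTI.
have mc : measurable_fun setT
    (fun z : Rd R d * Rd R d => z.1 ord0 i - z.2 ord0 i).
  apply: measurable_funB.
    exact: measurableT_comp (measurable_coord i) measurable_fst.
  exact: measurableT_comp (measurable_coord i) measurable_snd.
apply: mc => //; apply: open_measurable.
rewrite (_ : mkset _ = ball (ratr (p.1 ord0 i) : R) p.2.+1%:R^-1).
  exact: ball_open.
by apply/seteqP; split => t; rewrite /ball/= distrC.
Qed.

(** Lower semicontinuity makes the sets [t < K] open, and the rays []t, +oo]] generate the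
    sigma-algebra of the extended reals. *)
Lemma measurable_lsc_sub (K : 'rV[R]_d -> \bar R) : lower_semicontinuous K ->
  measurable_fun setT (fun z : Rd R d * Rd R d => K (z.1 - z.2)).
Proof.
move=> /lower_semicontinuousP K_lsc.
apply: (measurability (@ErealGenOInfty.G R) (ErealGenOInfty.measurableE R)).
move=> _ [_ [t ->] <-]; rewrite setTI.
rewrite (_ : _ @^-1` _ =
    [set z : Rd R d * Rd R d | [set x | (t%:E < K x)%E] (z.1 - z.2)]).
  exact: measurable_open_sub.
by apply/seteqP; split => z /=; rewrite in_itv/= andbT.
Qed.

End euclidean_measure.

(** * Lebesgue measure has no atoms *)

Lemma lipschitz_nondecreasing_continuous {R : realType} (f : R -> R) (C : R) :
  (forall s t, s <= t -> f s <= f t <= f s + C * (t - s)) -> continuous f.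
Proof.
move=> fC x.
have C0 : 0 <= C.
  by have /andP[h1 h2] := fC 0 1 ler01; have := le_trans h1 h2; lra.
apply/cvgrPdist_lt => e e0.
near=> y.
(* [C + 1] keeps the divisor positive when [C = 0]. *)
have : `|x - y| < e / (C + 1).
  by near: y; apply: cvgr_dist_lt => //; rewrite divr_gt0// ltr_wpDl.
rewrite ltr_pdivlMr ?ltr_wpDl// => xy.
apply: le_lt_trans xy; have [xy|/ltW xy] := leP x y.
  have /andP[f1 f2] := fC _ _ xy; rewrite ler0_norm ?subr_le0//.
  by rewrite ler0_norm ?subr_le0//; nra.
have /andP[f1 f2] := fC _ _ xy; rewrite ger0_norm ?subr_ge0//.
by rewrite ger0_norm ?subr_ge0//; nra.
Unshelve. all: by end_near. Qed.

(** This is the conclusion of Sierpinski's theorem on nonatomic measures, taken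
    here as the definition. *)
Definition nonatomic {d} {T : measurableType d} {R : realType}
    (mu : {measure set T -> \bar R}) :=
  forall (A : set T) (c : R), measurable A -> (mu A < +oo)%E ->
    0 <= c -> (c%:E <= mu A)%E ->
  exists B, [/\ measurable B, B `<=` A & mu B = c%:E].

Section nonatomic_lebesgue.
Context {R : realType} {d : nat}.
Local Notation mu := (@lebesgue_rV R d).

(** The slab is itself a box, of thickness at most [t - s]. Linearity in [t - s] yields the
    Lipschitz bound in the next proof. *)
Lemma lebesgue_rV_slab_le (i : 'I_d) (n : nat) (s t : R) : s <= t ->
  (mu (cube n `&` [set x | (x ord0 i <= t)%R] `&`
       ~` [set x | (x ord0 i <= s)%R]) <=
   ((\prod_(j < d | j != i) Num.max 0 (n%:R - - n%:R)) * (t - s))%:E)%E.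
Proof.
move=> st; rewrite -box_belowE -box_aboveE.
rewrite (le_trans (lebesgue_rV_box_le _))// lee_fin.
rewrite (bigD1 i)//= mulrC ler_pM//.
- by apply: prodr_ge0 => j _; rewrite le_max lexx.
- by rewrite le_max lexx.
- apply: ler_prod => j /negbTE ji; rewrite !mxE ji.
  by apply/andP; split => //; rewrite le_max lexx.
- rewrite !mxE eqxx ge_max subr_ge0 st/=.
  by rewrite lerB// ?ge_min ?lexx ?orbT// le_max lexx orbT.
Qed.

(** A hyperplane [x_i = t] is swept across a bounded part of [A]. The measure swept so far is
    Lipschitz in [t] and rises from 0 to more than [c], so the intermediate value theorem applies. A
    coordinate to sweep along exists because [d > 0]. *)
Lemma nonatomic_lebesgue_rV : (0 < d)%N -> nonatomic mu.
Proof.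
move=> d0 A c mA Aoo c0; rewrite le_eqVlt => /predU1P[cA|cA].
  by exists A; split.
pose i : 'I_d := Ordinal d0.
have mcube n : measurable (cube n : set (Rd R d)) by exact: measurable_box.
have [n An] : exists n, (c%:E < mu (A `&` cube n))%E.
  have cvgA : mu (A `&` cube n) @[n --> \oo] --> mu A.
    rewrite -[X in _ --> mu X]setIT -bigcup_cube setI_bigcupr.
    apply: nondecreasing_cvg_mu => [n||m n mn].
    - exact: measurableI.
    - by apply: bigcup_measurable => n _; exact: measurableI.
    - by apply/subsetPset; apply: setIS; exact: cube_nondecreasing.
  apply/not_existsP => h.
  have : (mu A <= c%:E)%E.
    apply: (cvge_le _ cvgA); apply: nearW => n.
    by rewrite leNgt; apply/negP/h.
  by rewrite leNgt cA.
pose H t : set (Rd R d) := [set x | x ord0 i <= t].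
pose S t := A `&` cube n `&` H t.
have mH t : measurable (H t) by exact: measurable_halfspace.
have mAn : measurable (A `&` cube n) by exact: measurableI.
have mS t : measurable (S t) by exact: measurableI.
have Sfin t : mu (S t) \is a fin_num.
  rewrite ge0_fin_numE// (le_lt_trans _ Aoo)// le_measure ?inE//.
  by move=> x [[]].
pose f t := fine (mu (S t)).
have fE t : (f t)%:E = mu (S t) by rewrite fineK.
pose C : R := \prod_(j < d | j != i) Num.max 0 (n%:R - - n%:R).
have fC s t : s <= t -> f s <= f t <= f s + C * (t - s).
  move=> st; rewrite -!lee_fin EFinD !fE.
  have sub : S s `<=` S t by move=> x [Ax xs]; split => //=; exact: le_trans st.
  rewrite le_measure ?inE//=.
  have -> : S t = S s `|` (S t `\` S s) by rewrite setDUK.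
  rewrite measureU//; [|exact: measurableD|by rewrite setDIK].
  rewrite leeD2l// (le_trans _ (lebesgue_rV_slab_le i n _ _ st))//.
  rewrite le_measure ?inE//.
  - exact: measurableD.
  - exact: (measurableI _ _ (measurableI _ _ (mcube n) (mH t))
      (measurableC (mH s))).
  - by move=> x [[[Ax nx] xt] nS]; split => //= xs; apply: nS.
(* The cube omits its left faces, so the sweep starts from the empty set. *)
have fN : f (- n%:R) = 0.
  rewrite /f (_ : S _ = set0) ?measure0//.
  apply/seteqP; split => // x [[_ xn] /= xi].
  by have := xn i; rewrite !mxE ltNge xi.
have fn : f n%:R = fine (mu (A `&` cube n)).
  congr (fine (mu _)); apply/seteqP; split => x; first by case.
  by move=> [Ax xn]; split => //=; have := xn i; rewrite !mxE => /andP[].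
have nn : - n%:R <= n%:R :> R.
  by rewrite lerNl (le_trans (_ : _ <= 0)) ?oppr_le0.
have cfn : c <= f n%:R.
  rewrite -lee_fin fn fineK ?(ltW An)// ge0_fin_numE// (le_lt_trans _ Aoo)//.
  by rewrite le_measure ?inE// => x [].
have fcont : {within `[- n%:R, n%:R], continuous f}.
  by apply: continuous_subspaceT; exact: lipschitz_nondecreasing_continuous fC.
have cf : Num.min (f (- n%:R)) (f n%:R) <= c <= Num.max (f (- n%:R)) (f n%:R).
  by rewrite fN ge_min c0 le_max cfn orbT.
have [t _ ft] := IVT nn fcont cf.
by exists (S t); split => //; [move=> x [[]]|rewrite -ft fE].
Qed.

End nonatomic_lebesgue.

(** * Interaction energies over a sigma-finite measure *)

Section interaction_energy.
Context {disp : measure_display} {T : measurableType disp} {R : realType}.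
Context (mu : {sigma_finite_measure set T -> \bar R}).
Implicit Types (k : T * T -> \bar R) (f g : T -> R) (A X Y : set T).

(** One integral over the product space, with a kernel on pairs: additivity and monotone convergence
    in [k] become directly available. [interaction_iterated] recovers the iterated form. *)
Definition interaction k f : \bar R :=
  (\int[mu \x mu]_z (k z * (f z.1 * f z.2)%:E))%E.

Definition density_on A f :=
  measurable_fun setT f /\ forall x, 0 <= f x <= \1_A x.

Definition nonneg_kernel k :=
  measurable_fun setT k /\ forall z, (0 <= k z)%E.

Lemma density_on_ge0 A f x : density_on A f -> 0 <= f x.
Proof. by move=> [_ /(_ x)/andP[]]. Qed.

Lemma measurable_tensor f : measurable_fun setT f ->
  measurable_fun setT (fun z : T * T => (f z.1 * f z.2)%:E).
Proof.
move=> mf; apply/measurable_EFinP; apply: measurable_funM.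
- exact: measurableT_comp mf measurable_fst.
- exact: measurableT_comp mf measurable_snd.
Qed.

Lemma measurable_interaction k f : measurable_fun setT k ->
  measurable_fun setT f ->
  measurable_fun setT (fun z => k z * (f z.1 * f z.2)%:E)%E.
Proof.
by move=> mk mf; apply: emeasurable_funM => //; exact: measurable_tensor.
Qed.

Lemma interaction_integrand_ge0 k f z : (forall z, (0 <= k z)%E) ->
  (forall x, 0 <= f x) -> (0 <= k z * (f z.1 * f z.2)%:E)%E.
Proof. by move=> k0 f0; rewrite mule_ge0// lee_fin mulr_ge0. Qed.

Lemma interaction_ge0 k f : (forall z, (0 <= k z)%E) ->
  (forall x, 0 <= f x) -> (0 <= interaction k f)%E.
Proof.
move=> k0 f0; apply: integral_ge0 => z _; exact: interaction_integrand_ge0.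
Qed.

Lemma le_interaction k f g : nonneg_kernel k ->
  measurable_fun setT f -> measurable_fun setT g ->
  (forall x, 0 <= f x <= g x) -> (interaction k f <= interaction k g)%E.
Proof.
move=> [mk k0] mf mg fg.
have f0 x : 0 <= f x by have /andP[] := fg x.
apply: ge0_le_integral => //.
- by move=> z _; exact: interaction_integrand_ge0.
- exact: measurable_interaction.
- exact: measurable_interaction.
- move=> z _; rewrite lee_wpmul2l// lee_fin.
  by apply: ler_pM => //; have /andP[] := fg z.1; have /andP[] := fg z.2.
Qed.

Lemma interactionD k1 k2 f : nonneg_kernel k1 -> nonneg_kernel k2 ->
  measurable_fun setT f -> (forall x, 0 <= f x) ->
  interaction (fun z => k1 z + k2 z)%E f =
  (interaction k1 f + interaction k2 f)%E.
Proof.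
move=> [mk1 k10] [mk2 k20] mf f0; rewrite /interaction -ge0_integralD//.
- by apply: eq_integral => z _; rewrite ge0_muleDl.
- by move=> z _; exact: interaction_integrand_ge0.
- exact: measurable_interaction.
- by move=> z _; exact: interaction_integrand_ge0.
- exact: measurable_interaction.
Qed.

Lemma interactionZ (c : R) k f : 0 <= c -> nonneg_kernel k ->
  measurable_fun setT f -> (forall x, 0 <= f x) ->
  interaction (fun z => c%:E * k z)%E f = (c%:E * interaction k f)%E.
Proof.
move=> c0 [mk k0] mf f0; rewrite /interaction -ge0_integralZl//.
- by apply: eq_integral => z _; rewrite muleA.
- exact: measurable_interaction.
- by move=> z _; exact: interaction_integrand_ge0.
Qed.

Lemma interaction_scale (c : R) k f : 0 <= c -> nonneg_kernel k ->
  measurable_fun setT f -> (forall x, 0 <= f x) ->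
  interaction k (fun x => c * f x) = ((c ^+ 2)%:E * interaction k f)%E.
Proof.
move=> c0 [mk k0] mf f0; rewrite /interaction -ge0_integralZl//.
- by apply: eq_integral => z _; rewrite mulrACA EFinM muleCA expr2.
- exact: measurable_interaction.
- by move=> z _; exact: interaction_integrand_ge0.
- by rewrite lee_fin sqr_ge0.
Qed.

Lemma interaction_iterated k f : nonneg_kernel k ->
  measurable_fun setT f -> (forall x, 0 <= f x) ->
  interaction k f =
  (\int[mu]_y \int[mu]_x (k (x, y) * (f x)%:E * (f y)%:E))%E.
Proof.
move=> [mk k0] mf f0; rewrite /interaction fubini_tonelli2.
- apply: eq_integral => y _; apply: eq_integral => x _ /=.
  by rewrite EFinM muleA.
- exact: measurable_interaction.
- by move=> z; exact: interaction_integrand_ge0.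
Qed.

(** By Tonelli the variables separate, so [f] enters only through its integrals over [X] and [Y].
    This is the base case for the test sets below. *)
Lemma interaction_rectangle X Y f : measurable X -> measurable Y ->
  measurable_fun setT f -> (forall x, 0 <= f x) ->
  interaction (fun z => (\1_(X `*` Y) z)%:E) f =
  ((\int[mu]_(x in X) (f x)%:E) * (\int[mu]_(y in Y) (f y)%:E))%E.
Proof.
move=> mX mY mf f0.
have nnXY : nonneg_kernel (fun z => (\1_(X `*` Y) z)%:E).
  split => [|z]; last by rewrite lee_fin.
  by apply/measurable_EFinP; apply: measurable_indic; exact: measurableX.
have fE Z : (\int[mu]_(x in Z) (f x)%:E = \int[mu]_x (\1_Z x * f x)%:E)%E.
  rewrite integral_mkcond; apply: eq_integral => x _; rewrite patchE indicE.
  by case: ifP => _; rewrite ?mul1r ?mul0r.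
rewrite interaction_iterated// !fE.
have mZ Z : measurable Z -> measurable_fun setT (fun x => (\1_Z x * f x)%:E).
  by move=> ?; apply/measurable_EFinP; apply: measurable_funM.
rewrite -ge0_integralZl//; last 3 first.
- exact: mZ.
- by move=> y _; rewrite lee_fin mulr_ge0.
- by apply: integral_ge0 => x _; rewrite lee_fin mulr_ge0.
apply: eq_integral => y _; rewrite muleC -ge0_integralZl//; last 3 first.
- exact: mZ.
- by move=> x _; rewrite lee_fin mulr_ge0.
- by rewrite lee_fin mulr_ge0.
apply: eq_integral => x _; rewrite -!EFinM; congr EFin.
have -> : \1_(X `*` Y) (x, y) = \1_X x * \1_Y y :> R.
  by rewrite !indicE in_setX -mulnb natrM.
by ring.
Qed.

End interaction_energy.

(** * Energies controlled by finitely many integrals *)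

Section finite_tests.
Context {disp : measure_display} {T : measurableType disp} {R : realType}.
Context (mu : {sigma_finite_measure set T -> \bar R}).
Context (A : set T) (mA : measurable A) (Afin : (mu A < +oo)%E).
Implicit Types (k : T * T -> \bar R) (f g : T -> R) (X Y : set T)
  (E : set (T * T)) (s : seq (set T)).

Definition agree_on s f g :=
  forall X, X \in s ->
    (\int[mu]_(x in X) (f x)%:E = \int[mu]_(x in X) (g x)%:E)%E.

(** One inequality is enough: agreement on the tests is symmetric, so exchanging [f] and [g] gives
    the other one. *)
Definition determined_by_tests k := forall e : R, 0 < e ->
  exists2 s, (forall X, X \in s -> measurable X) &
    forall f g, density_on A f -> density_on A g -> agree_on s f g ->
      (interaction mu k f <= interaction mu k g + e%:E)%E.

Let ind E (z : T * T) : \bar R := (\1_E z)%:E.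

Let nonneg_ind E : measurable E -> nonneg_kernel (ind E).
Proof.
move=> mE; split => [|z]; last by rewrite lee_fin.
by apply/measurable_EFinP; apply: measurable_indic.
Qed.

Lemma agree_on_cat s1 s2 f g :
  agree_on (s1 ++ s2) f g -> agree_on s1 f g /\ agree_on s2 f g.
Proof.
by move=> fg; split => X Xs; apply: fg; rewrite mem_cat Xs ?orbT.
Qed.

Lemma determined_rectangle X Y : measurable X -> measurable Y ->
  determined_by_tests (ind (X `*` Y)).
Proof.
move=> mX mY e e0; exists [:: X; Y].
  by move=> Z; rewrite !inE => /orP[] /eqP ->.
move=> f g fA gA fg.
rewrite !interaction_rectangle//; try by [case: fA|case: gA]; last 2 first.
- by move=> x; exact: density_on_ge0 gA.
- by move=> x; exact: density_on_ge0 fA.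
rewrite (fg X) ?inE ?eqxx// (fg Y) ?inE ?eqxx ?orbT//.
by rewrite leeDl// lee_fin ltW.
Qed.

Lemma determinedD k1 k2 : nonneg_kernel k1 -> nonneg_kernel k2 ->
  determined_by_tests k1 -> determined_by_tests k2 ->
  determined_by_tests (fun z => k1 z + k2 z)%E.
Proof.
move=> nk1 nk2 dk1 dk2 e e0.
have e20 : 0 < e / 2 by rewrite divr_gt0.
have [s1 ms1 h1] := dk1 _ e20; have [s2 ms2 h2] := dk2 _ e20.
exists (s1 ++ s2).
  by move=> X; rewrite mem_cat => /orP[/ms1|/ms2].
move=> f g fA gA /agree_on_cat[fg1 fg2].
rewrite !interactionD//; try by [case: fA|case: gA]; last 2 first.
- by move=> x; exact: density_on_ge0 gA.
- by move=> x; exact: density_on_ge0 fA.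
by rewrite (splitr e) EFinD [leRHS]addeACA; apply: leeD; [exact: h1|exact: h2].
Qed.

Lemma determinedZ (c : R) k : 0 <= c -> nonneg_kernel k ->
  determined_by_tests k -> determined_by_tests (fun z => c%:E * k z)%E.
Proof.
move=> c0 nk dk e e0.
(* [c + 1] avoids a division by zero when [c = 0]. *)
have e0' : 0 < e / (c + 1) by rewrite divr_gt0// ltr_wpDl.
have [s ms h] := dk _ e0'; exists s => // f g fA gA fg.
rewrite !interactionZ//; try by [case: fA|case: gA]; last 2 first.
- by move=> x; exact: density_on_ge0 gA.
- by move=> x; exact: density_on_ge0 fA.
apply: (@le_trans _ _ (c%:E * (interaction mu k g + (e / (c + 1))%:E))%E).
  by rewrite lee_wpmul2l ?lee_fin// h.
rewrite ge0_muleDr ?leeD2l//.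
- rewrite -EFinM lee_fin mulrCA ger_pMr//.
  by rewrite ler_pdivrMr ?ltr_wpDl// mul1r lerDl.
- by apply: interaction_ge0; [case: nk|move=> x; exact: density_on_ge0 gA].
- by rewrite lee_fin ltW.
Qed.

Lemma determined0 : determined_by_tests (fun=> 0%E).
Proof.
move=> e e0; exists [::] => // f g _ _ _; rewrite /interaction.
under eq_integral do rewrite mul0e.
under [X in (_ <= X + _)%E]eq_integral do rewrite mul0e.
by rewrite integral0 add0e lee_fin ltW.
Qed.

(** Both conclusions are carried through the induction together, since [determinedD] needs the
    partial sum to be a nonnegative kernel. *)
Lemma determined_sum (I : eqType) (l : seq I) (F : I -> T * T -> \bar R) :
  (forall i, i \in l -> nonneg_kernel (F i) /\ determined_by_tests (F i)) ->
  nonneg_kernel (fun z => \sum_(i <- l) F i z)%E /\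
  determined_by_tests (fun z => \sum_(i <- l) F i z)%E.
Proof.
elim: l => [|i l IH] h.
  rewrite (_ : (fun z => _) = fun=> 0%E).
    by split; [split|exact: determined0].
  by apply/funext => z; rewrite big_nil.
have [nki dki] := h _ (mem_head _ _).
have [nkl dkl] := IH (fun j jl => h j (mem_behead (s := i :: l) jl)).
rewrite (_ : (fun z => _) =
    fun z => (F i z + \sum_(j <- l) F j z)%E); last first.
  by apply/funext => z; rewrite big_cons.
split; last exact: determinedD.
split; first by apply: emeasurable_funD; [case: nki|case: nkl].
by move=> z; apply: adde_ge0; [case: nki|case: nkl].
Qed.

Lemma interaction_dominated k f : nonneg_kernel k -> density_on A f ->
  (interaction mu k f <= interaction mu k \1_A)%E.
Proof. by move=> nk fA; apply: le_interaction => //; case: fA. Qed.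

Lemma determined_approx k : nonneg_kernel k ->
  (forall e : R, 0 < e -> exists k' r, [/\ nonneg_kernel k' /\ nonneg_kernel r,
     determined_by_tests k', (forall z, k z = k' z + r z)%E &
     (interaction mu r \1_A <= e%:E)%E]) ->
  determined_by_tests k.
Proof.
move=> nk h e e0; have e20 : 0 < e / 2 by rewrite divr_gt0.
have [k' [r [[nk' nr] dk' kE re]]] := h _ e20.
have [s ms hs] := dk' _ e20; exists s => // f g fA gA fg.
have fE f' : density_on A f' ->
    interaction mu k f' = (interaction mu k' f' + interaction mu r f')%E.
  move=> f'A; rewrite -interactionD//; first by congr interaction; exact/funext.
  - by case: f'A.
  - by move=> x; exact: density_on_ge0 f'A.
rewrite (fE f)// (splitr e) EFinD [leRHS]addeA; apply: leeD; last first.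
  exact: le_trans (interaction_dominated _ _ nr fA) re.
apply: (le_trans (hs _ _ fA gA fg)); rewrite leeD2r// fE// leeDl//.
by apply: interaction_ge0; [case: nr|move=> x; exact: density_on_ge0 gA].
Qed.

(** By monotone convergence the energies of [\1_A] under [k_ n] increase to a finite limit, so the
    remainder [k - k_ n] is eventually small. The approximants are real-valued, so this difference
    is never of the form [oo - oo]. *)
Lemma determined_lim k (k_ : nat -> T * T -> R) : nonneg_kernel k ->
  (interaction mu k \1_A < +oo)%E ->
  (forall n,
    nonneg_kernel (EFin \o k_ n) /\ determined_by_tests (EFin \o k_ n)) ->
  (forall z, nondecreasing_seq (k_ ^~ z)) ->
  (forall z, (k_ n z)%:E @[n --> \oo] --> k z) ->
  determined_by_tests k.
Proof.
move=> nk kfin hk_ ndk cvk; apply: determined_approx => // e e0.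
have mAf : measurable_fun setT (\1_A : T -> R) by [].
have A0 x : 0 <= \1_A x :> R by rewrite indicE ler0n.
have k_k n z : ((k_ n z)%:E <= k z)%E.
  apply: (cvge_ge _ (cvk z)); exists n => // i /= ni.
  by rewrite lee_fin; exact: ndk.
have cvI : interaction mu (EFin \o k_ n) \1_A @[n --> \oo] -->
    interaction mu k \1_A.
  rewrite /interaction.
  rewrite [X in _ --> X](_ : _ = \int[mu \x mu]_z
      limn (fun n => ((k_ n z)%:E * (\1_A z.1 * \1_A z.2)%:E)))%E.
    apply: cvg_monotone_convergence => //.
    - by move=> n; apply: measurable_interaction => //; case: (hk_ n) => -[].
    - move=> n z _; apply: interaction_integrand_ge0 => //.
      by case: (hk_ n) => -[].
    - by move=> z _ i j ij; rewrite lee_wpmul2r ?lee_fin ?mulr_ge0// ndk.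
  apply: eq_integral => z _; apply/esym/cvg_lim => //.
  by apply: cvgeZr => //; exact: cvk.
have kfn : interaction mu k \1_A \is a fin_num.
  by rewrite ge0_fin_numE//; apply: interaction_ge0; case: nk.
have [n hn] : exists n,
    (interaction mu k \1_A <= interaction mu (EFin \o k_ n) \1_A + e%:E)%E.
  apply/not_existsP => h.
  have : (interaction mu k \1_A <= interaction mu k \1_A - e%:E)%E.
    apply: (cvge_le _ cvI); apply: nearW => n.
    by rewrite leeBrDr//; apply/ltW; rewrite ltNge; apply/negP/h.
  by rewrite leNgt lteBlDr// lteDl// lte_fin e0.
have nr : nonneg_kernel (fun z => k z - (k_ n z)%:E)%E.
  split; last by move=> z; rewrite sube_ge0.
  by apply: emeasurable_funB; [case: nk|case: (hk_ n) => -[]].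
have kr z : k z = ((k_ n z)%:E + (k z - (k_ n z)%:E))%E by rewrite addeC subeK.
exists (EFin \o k_ n), (fun z => k z - (k_ n z)%:E)%E; split.
- by split => //; case: (hk_ n).
- by case: (hk_ n).
- exact: kr.
have kE : interaction mu k \1_A = (interaction mu (EFin \o k_ n) \1_A +
    interaction mu (fun z => k z - (k_ n z)%:E) \1_A)%E.
  rewrite -interactionD//; last by case: (hk_ n).
  by congr interaction; exact/funext.
have I1 : (0 <= interaction mu (EFin \o k_ n) \1_A)%E.
  by apply: interaction_ge0 => //; case: (hk_ n) => -[].
have I2 : (0 <= interaction mu (fun z => k z - (k_ n z)%:E) \1_A)%E.
  by apply: interaction_ge0 => //; case: nr.
have I1fin : interaction mu (EFin \o k_ n) \1_A \is a fin_num.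
  by rewrite ge0_fin_numE// (le_lt_trans _ kfin)// kE leeDl.
by move: hn; rewrite {1}kE leeD2lE.
Qed.

Lemma interaction_ind_fin E : measurable E ->
  (interaction mu (ind E) \1_A < +oo)%E.
Proof.
move=> mE.
apply: (@le_lt_trans _ _ (interaction mu (ind (setT `*` setT)) \1_A)).
  apply: ge0_le_integral => //.
  - move=> z _; apply: interaction_integrand_ge0 => //.
    by case: (nonneg_ind _ mE).
  - by apply: measurable_interaction => //; case: (nonneg_ind _ mE).
  - apply: measurable_interaction => //; rewrite setXTT.
    by case: (nonneg_ind _ measurableT).
  - move=> z _; rewrite lee_wpmul2r ?lee_fin ?mulr_ge0 ?indicE ?ler0n//.
    by rewrite setXTT in_setT ler_nat; case: (_ \in _).
rewrite interaction_rectangle// !integral_indic//.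
by rewrite setIT lte_mul_pinfty// ge0_fin_numE.
Qed.

(** The constant kernel 1 is a rectangle, and the extra test [setT] fixes its energy exactly.
    Subtracting the energy of [E], which is finite, reverses the inequality, so the bound for [E] is
    used with [f] and [g] exchanged. *)
Lemma determined_setC E : measurable E ->
  determined_by_tests (ind E) -> determined_by_tests (ind (~` E)).
Proof.
move=> mE dE e e0; have [s ms hs] := dE _ e0.
exists (setT :: s).
  by move=> X; rewrite inE => /predU1P[->|/ms].
move=> f g fA gA fg.
have gf : agree_on s g f by move=> X Xs; rewrite fg// inE Xs orbT.
have cE f' : density_on A f' ->
    interaction mu (ind setT) f' =
    (interaction mu (ind E) f' + interaction mu (ind (~` E)) f')%E.
  move=> f'A; rewrite -interactionD//.
  - congr interaction; apply/funext => z.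
    rewrite /ind -EFinD !indicE in_setC in_setT.
    by case: (_ \in _); rewrite ?addr0 ?add0r.
  - exact: nonneg_ind.
  - by apply: nonneg_ind; exact: measurableC.
  - by case: f'A.
  - by move=> x; exact: density_on_ge0 f'A.
have TE : interaction mu (ind setT) f = interaction mu (ind setT) g.
  rewrite -setXTT !interaction_rectangle//; try by [case: fA|case: gA];
    last 2 first.
  - by move=> x; exact: density_on_ge0 gA.
  - by move=> x; exact: density_on_ge0 fA.
  by rewrite fg// inE eqxx.
have fin f' : density_on A f' -> interaction mu (ind E) f' \is a fin_num.
  move=> f'A; rewrite ge0_fin_numE; last first.
    apply: interaction_ge0 => [z|x]; first by rewrite lee_fin.
    exact: density_on_ge0 f'A.
  apply: le_lt_trans (interaction_ind_fin _ mE).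
  by apply: interaction_dominated => //; exact: nonneg_ind.
have fE := fin _ fA.
rewrite -(@leeD2lE _ (interaction mu (ind E) f))// -cE// TE cE//.
rewrite [leLHS]addeC [leRHS]addeCA; apply: leeD2l; exact: hs.
Qed.

(** For disjoint sets the indicator of the union is the increasing limit of the finite sums of
    indicators. *)
Lemma determined_bigcup (F : (set (T * T))^nat) :
  (forall n, measurable (F n)) -> trivIset setT F ->
  (forall n, determined_by_tests (ind (F n))) ->
  determined_by_tests (ind (\bigcup_n F n)).
Proof.
move=> mF tF dF.
have mU : measurable (\bigcup_n F n) by exact: bigcup_measurable.
pose k_ n z : R := \sum_(0 <= i < n) \1_(F i) z.
have k_E n : EFin \o k_ n = fun z => (\sum_(0 <= i < n) ind (F i) z)%E.
  by apply/funext => z; rewrite /= sumEFin.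
apply: (@determined_lim _ k_).
- exact: nonneg_ind.
- exact: interaction_ind_fin.
- move=> n; rewrite k_E; apply: determined_sum => i _; split => //.
  exact: nonneg_ind.
- by move=> z; apply/nondecreasing_seqP => n; rewrite /k_ big_nat_recr//= lerDl.
- move=> z; rewrite /ind indic_bigcup//.
  rewrite (_ : (fun n => _) = fun n => (\sum_(0 <= i < n) ind (F i) z)%E).
    by apply: is_cvg_nneseries => i _ _; rewrite lee_fin.
  by apply/funext => n; rewrite -sumEFin.
Qed.

(** Dynkin's theorem: measurable rectangles are stable under intersection and generate the product
    sigma-algebra. *)
Lemma determined_measurable E : measurable E -> determined_by_tests (ind E).
Proof.
rewrite measurable_prod_measurableType.
apply: (@dynkin_induction _ _ _ (fun E => determined_by_tests (ind E))).
- exact: measurable_prod_measurableType.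
- move=> _ _ [X1 mX1 [Y1 mY1 <-]] [X2 mX2 [Y2 mY2 <-]].
  exists (X1 `&` X2); first exact: measurableI.
  exists (Y1 `&` Y2); first exact: measurableI.
  by rewrite setXI.
- by rewrite -setXTT; exact: determined_rectangle.
- by move=> _ [X mX [Y mY <-]]; exact: determined_rectangle.
- exact: determined_setC.
- exact: determined_bigcup.
Qed.

Import HBNNSimple.

Lemma determined_nnsfun (h : {nnsfun T * T >-> R}) :
  determined_by_tests (fun z => (h z)%:E).
Proof.
rewrite (_ : (fun z => _) = fun z =>
    (\sum_(y <- finmap.enum_fset (fset_set (range h)))
      y%:E * ind (h @^-1` [set y]) z)%E); last first.
  apply/funext => z; rewrite /= fimfunE fsbig_finite//= -sumEFin.
  by apply: eq_bigr => y _.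
apply: (determined_sum _ _ _ _).2 => y; rewrite in_fset_set// inE => -[z _ <-].
have mh : measurable (h @^-1` [set h z]) by [].
have [mi i0] := nonneg_ind _ mh.
split; last by apply: determinedZ => //; exact: determined_measurable.
split; first exact: measurable_funeM.
by move=> z'; rewrite mule_ge0// lee_fin.
Qed.

(** [k] is the increasing limit of nonnegative simple functions. *)
Lemma determined_integrable k : nonneg_kernel k ->
  (interaction mu k \1_A < +oo)%E -> determined_by_tests k.
Proof.
move=> nk kfin; have [mk k0] := nk.
pose h := nnsfun_approx measurableT mk.
apply: (@determined_lim _ h) => //.
- move=> n; split; last exact: determined_nnsfun.
  by split => [|z]; [exact/measurable_EFinP|rewrite lee_fin].
- by move=> z m n mn; exact/lefP/nd_nnsfun_approx.
- by move=> z; exact: cvg_nnsfun_approx.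
Qed.

End finite_tests.

(** * Replacing a density by a set of the same mass *)

Section set_approximation.
Context {disp : measure_display} {T : measurableType disp} {R : realType}.
Context (mu : {sigma_finite_measure set T -> \bar R}).
Context (mu_nonatomic : nonatomic mu).
Implicit Types (k : T * T -> \bar R) (f g sigma rho : T -> R) (A X Y : set T).

(** Induction on the tests, with [A] varying: the first test splits [A] in two, and the sets found
    in the two halves are united. With no test left, [sigma <= 1] bounds the required mass by
    [mu A], and nonatomicity supplies the set. The equation for the total mass becomes, one level
    up, the equation for the test [X]. *)
Lemma exists_set_same_tests sigma (s : seq (set T)) A :
  measurable_fun setT sigma -> (forall x, 0 <= sigma x <= 1) ->
  (forall X, X \in s -> measurable X) -> measurable A -> (mu A < +oo)%E ->
  exists Omega, [/\ measurable Omega, Omega `<=` A,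
    (mu Omega = \int[mu]_(x in A) (sigma x)%:E)%E &
    forall X, X \in s ->
      (mu (Omega `&` X) = \int[mu]_(x in A `&` X) (sigma x)%:E)%E].
Proof.
move=> msigma sigma01.
have sigma0 x : 0 <= sigma x by have /andP[] := sigma01 x.
have msE D : measurable_fun D (EFin \o sigma).
  by apply/measurable_EFinP; exact: measurable_funTS.
elim: s A => [|X s IH] A ms mA Afin.
  have le_muA : (\int[mu]_(x in A) (sigma x)%:E <= mu A)%E.
    rewrite -[leRHS]mul1e -integral_cst//; apply: ge0_le_integral => //.
    - by move=> x _; rewrite lee_fin.
    - by move=> x _; rewrite lee_fin; have /andP[] := sigma01 x.
  have I0 : (0 <= \int[mu]_(x in A) (sigma x)%:E)%E.
    by apply: integral_ge0 => x _; rewrite lee_fin.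
  have Ifin : (\int[mu]_(x in A) (sigma x)%:E)%E \is a fin_num.
    by rewrite ge0_fin_numE// (le_lt_trans le_muA).
  have [B [mB BA muB]] : exists B, [/\ measurable B, B `<=` A &
      mu B = (fine (\int[mu]_(x in A) (sigma x)%:E))%:E].
    by apply: mu_nonatomic => //; [exact: fine_ge0|rewrite fineK].
  by exists B; split => //; rewrite muB fineK.
have mX : measurable X by apply: ms; rewrite inE eqxx.
have ms' Y : Y \in s -> measurable Y.
  by move=> Ys; apply: ms; rewrite inE Ys orbT.
have mAX : measurable (A `&` X) by exact: measurableI.
have mADX : measurable (A `\` X) by exact: measurableD.
have fin B : measurable B -> B `<=` A -> (mu B < +oo)%E.
  by move=> mB BA; rewrite (le_lt_trans _ Afin)// le_measure ?inE.
have [U1 [mO1 O1A muO1 O1s]] := IH _ ms' mAX (fin _ mAX (@subIsetl _ _ _)).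
have [U2 [mO2 O2A muO2 O2s]] := IH _ ms' mADX (fin _ mADX (@subDsetl _ _ _)).
have O12 : [disjoint U1 & U2].
  apply/disj_setPS => x [/O1A[_ Xx] /O2A[_]]; exact.
have splitX Y : measurable Y ->
    (\int[mu]_(x in A `&` Y) (sigma x)%:E =
     \int[mu]_(x in A `&` X `&` Y) (sigma x)%:E +
     \int[mu]_(x in (A `\` X) `&` Y) (sigma x)%:E)%E.
  move=> mY; rewrite -ge0_integral_setU//.
  - by rewrite -setIUl setUIDK.
  - exact: measurableI.
  - exact: measurableI.
  - by move=> x _; rewrite lee_fin.
  - by apply/disj_setPS => x [[[_ Xx] _] [[_ nXx] _]].
exists (U1 `|` U2); split.
- exact: measurableU.
- by move=> x [/O1A[]|/O2A[]].
- rewrite measureU//; last by apply/eqP.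
  have := splitX setT measurableT; rewrite !setIT => ->.
  by congr (_ + _)%E; [exact: muO1|exact: muO2].
- move=> Y; rewrite inE => /predU1P[->|Ys].
    rewrite setIUl (_ : U1 `&` X = U1); last first.
      by apply/setIidPl => x /O1A[].
    rewrite (_ : U2 `&` X = set0) ?setU0//.
    by apply/seteqP; split => // x [/O2A[_ nX]].
  rewrite setIUl measureU;
    [|exact: measurableI (ms' _ Ys)|exact: measurableI (ms' _ Ys)|].
    by rewrite (splitX _ (ms' _ Ys)); congr (_ + _)%E; [exact: O1s|exact: O2s].
  by apply/seteqP; split => // x [[/O1A[_ Xx] _] [/O2A[_ nX] _]].
Qed.

Lemma set_approx_density_on k sigma A (e : R) :
  measurable A -> (mu A < +oo)%E -> density_on A sigma -> nonneg_kernel k ->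
  (interaction mu k \1_A < +oo)%E -> 0 < e ->
  exists Omega, [/\ measurable Omega, (mu Omega = \int[mu]_x (sigma x)%:E)%E &
    (interaction mu k \1_Omega <= interaction mu k sigma + e%:E)%E].
Proof.
move=> mA Afin sigmaA nk kfin e0; have [msigma sA] := sigmaA.
have s01 x : 0 <= sigma x <= 1.
  by have /andP[-> sx] := sA x; rewrite (le_trans sx).
have [s ms hs] := determined_integrable mu A mA Afin _ nk kfin _ e0.
have [ Omega [mO OA muO Os]] :=
  exists_set_same_tests _ s A msigma s01 ms mA Afin.
(* [sigma] vanishes outside [A]. *)
have on_A X : (\int[mu]_(x in A `&` X) (sigma x)%:E =
    \int[mu]_(x in X) (sigma x)%:E)%E.
  rewrite setIC integral_mkcondr; apply: eq_integral => x _.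
  rewrite patchE; case: ifPn => // xA.
  by have := sA x; rewrite indicE (negbTE xA) -eq_le => /eqP <-.
exists Omega; split => //; first by rewrite muO -[in LHS](setIT A) on_A.
apply: hs => //.
  split => // x; rewrite !indicE ler0n ler_nat/=.
  by case: (boolP (x \in Omega)) => //; rewrite inE => /OA xA; rewrite mem_set.
move=> X Xs; rewrite integral_indic//; last exact: ms.
exact: etrans (Os _ Xs) (on_A _).
Qed.

Lemma measurable_superlevel rho (r : R) : measurable_fun setT rho ->
  measurable [set x | r <= rho x].
Proof.
move=> mrho; rewrite -[X in measurable X]setTI.
rewrite (_ : mkset _ = rho @^-1` `[r, +oo[); first exact: mrho.
by apply/seteqP; split => x /=; rewrite in_itv/= andbT.
Qed.

Lemma measurable_sublevel rho (r : R) : measurable_fun setT rho ->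
  measurable [set x | rho x <= r].
Proof.
move=> mrho; rewrite -[X in measurable X]setTI.
rewrite (_ : mkset _ = rho @^-1` `]-oo, r]); first exact: mrho.
by apply/seteqP; split => x /=; rewrite in_itv.
Qed.

(** Markov's inequality. *)
Lemma superlevel_set_finite rho (r : R) : measurable_fun setT rho ->
  (forall x, 0 <= rho x) -> (\int[mu]_x (rho x)%:E < +oo)%E -> 0 < r ->
  (mu [set x | (r <= rho x)%R] < +oo)%E.
Proof.
move=> mrho rho0 rhofin r0.
have mA := measurable_superlevel _ r mrho.
have : (r%:E * mu [set x | (r <= rho x)%R] < +oo)%E.
  rewrite -integral_cst//; apply: le_lt_trans rhofin.
  apply: (@le_trans _ _
    (\int[mu]_(x in [set x | (r <= rho x)%R]) (rho x)%:E)%E).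
    apply: ge0_le_integral => //.
    - by move=> x _; rewrite lee_fin ltW.
    - by apply/measurable_EFinP; exact: measurable_funTS.
  apply: ge0_subset_integral => //; first exact/measurable_EFinP.
  by move=> x _; rewrite lee_fin.
apply: contraLR; rewrite -!leNgt !leye_eq => /eqP ->.
by rewrite gt0_muley// lte_fin.
Qed.

Theorem set_approx_density k rho (e : R) :
  measurable_fun setT rho -> (forall x, 0 <= rho x <= 1) ->
  (\int[mu]_x (rho x)%:E < +oo)%E -> nonneg_kernel k ->
  (interaction mu k rho < +oo)%E -> 0 < e ->
  exists Omega, [/\ measurable Omega, (mu Omega = \int[mu]_x (rho x)%:E)%E &
    (interaction mu k \1_Omega <= interaction mu k rho + e%:E)%E].
Proof.
move=> mrho rho01 rhofin nk kfin e0.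
have rho0 x : 0 <= rho x by have /andP[] := rho01 x.
have rho1 x : rho x <= 1 by have /andP[] := rho01 x.
have msup r := measurable_superlevel _ r mrho.
have minf r := measurable_sublevel _ r mrho.
pose d_ n : R := n.+1%:R^-1.
have d_0 n : 0 < d_ n by rewrite invr_gt0.
pose B n := [set x | d_ n <= rho x] `&` [set x | rho x <= 1 - d_ n].
have mB n : measurable (B n) by exact: measurableI.
(* The sets [B n] exhaust the region [0 < rho < 1]. If all are null, [rho] is almost everywhere the
   indicator of the set where it equals 1. *)
have [B0|] := pselect (forall n, mu (B n) = 0%E).
  exists [set x | 1 <= rho x]; split => //.
    have -> : (\int[mu]_x (rho x)%:E =
        \int[mu]_x (\1_[set x | (1 <= rho x)%R] x)%:E)%E.
      apply: ge0_ae_eq_integral => //.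
      - exact/measurable_EFinP.
      - exact/measurable_EFinP/measurable_indic.
      - by move=> x _; rewrite lee_fin.
      - have : mu.-negligible (\bigcup_n B n).
          by apply: negligible_bigcup => n; apply/negligibleP => //; exact: B0.
        apply: negligibleS => x /= /not_implyP[_ neq].
        have lt1 : rho x < 1.
          rewrite lt_neqAle rho1 andbT; apply/eqP => rx1; apply: neq.
          by rewrite rx1 indicE mem_set//= rx1.
        have gt0 : 0 < rho x.
          rewrite lt_neqAle rho0 andbT; apply/eqP => rx0; apply: neq.
          by rewrite -rx0 indicE memNset//= -rx0; apply/negP; rewrite -ltNge.
        pose q := Num.min (rho x) (1 - rho x).
        have q0 : 0 < q by rewrite lt_min gt0 subr_gt0.
        have [n nq] : exists n, d_ n <= q.
          exists (Num.trunc q^-1); rewrite /d_ invf_ple ?posrE//.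
          by rewrite ltW// truncnS_gt.
        move: nq; rewrite le_min => /andP[nq1 nq2].
        by exists n => //; split => //=; rewrite lerBrDr -lerBrDl.
    by rewrite integral_indic// setIT.
  apply: (@le_trans _ _ (interaction mu k rho)); last first.
    by rewrite leeDl// lee_fin ltW.
  apply: le_interaction => // x; rewrite indicE ler0n/=.
  by case: (boolP (x \in _)); rewrite ?inE.
move=> /existsNP[j Bj].
have muB0 : (0 < mu (B j))%E.
  by rewrite lt0e; apply/andP; split => //; exact/eqP.
have Bsup : B j `<=` [set x | d_ j <= rho x] by move=> x [].
have muBfin : (mu (B j) < +oo)%E.
  apply: le_lt_trans (superlevel_set_finite _ _ mrho rho0 rhofin (d_0 j)).
  by rewrite le_measure ?inE.
pose b := fine (mu (B j)).
have bE : mu (B j) = b%:E by rewrite fineK// ge0_fin_numE.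
have b0 : 0 < b by rewrite -lte_fin -bE.
pose I := fine (interaction mu k rho).
have I0' : (0 <= interaction mu k rho)%E.
  by apply: interaction_ge0 => //; case: nk.
have IE : interaction mu k rho = I%:E by rewrite fineK// ge0_fin_numE.
have I0 : 0 <= I by rewrite -lee_fin -IE.
(* For [u <= 1] one has [(1 + u) ^+ 2 <= 1 + 3 * u], so scaling a density by [1 + u] adds at most
   [3 * u * I <= e / 2] to the energy. [I + 1] is positive even if [I = 0]. *)
pose u := Num.min 1 (e / 2 / (3 * (I + 1))).
have u0 : 0 < u.
  by rewrite lt_min ltr01/= !divr_gt0// mulr_gt0// ltr_wpDl.
have u1 : u <= 1 by rewrite ge_min lexx.
have uI : (1 + u) ^+ 2 * I <= I + e / 2.
  have : u * (3 * (I + 1)) <= e / 2.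
    by rewrite -ler_pdivlMr ?mulr_gt0 ?ltr_wpDl// ge_min lexx orbT.
  nra.
pose A n := [set x | d_ n <= rho x].
have d_le m n : (m <= n)%N -> d_ n <= d_ m.
  by move=> mn; rewrite lef_pV2 ?posrE ?ltr0n// ler_nat.
have A_nd m n : (m <= n)%N -> A m `<=` A n.
  by move=> mn x /=; apply: le_trans; exact: d_le.
(* The mass of [rho] outside [A n] tends to 0. The threshold [u * d_ j * b] is the mass of a
   constant density [u * d_ j] on [B j]. *)
have [n jn tail] : exists2 n, (j <= n)%N &
    (\int[mu]_x (rho x)%:E <=
     \int[mu]_x (rho x * \1_(A n) x)%:E + (u * d_ j * b)%:E)%E.
  pose r n := (\int[mu]_x (rho x * \1_(A n) x)%:E)%E.
  have cvr : r n @[n --> \oo] --> (\int[mu]_x (rho x)%:E)%E.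
    rewrite [X in _ --> X](_ : _ = \int[mu]_x
        limn (fun n => (rho x * \1_(A n) x)%:E))%E.
      apply: cvg_monotone_convergence => //.
      - move=> n; apply/measurable_EFinP; apply: measurable_funM => //.
        by apply: measurable_indic; exact: msup.
      - by move=> n x _; rewrite lee_fin mulr_ge0.
      - move=> x _ i l il; rewrite lee_fin ler_wpM2l// !indicE ler_nat.
        case: (boolP (x \in A i)) => //; rewrite inE => /(A_nd _ _ il) xl.
        by rewrite mem_set.
    apply: eq_integral => x _; apply/esym/cvg_lim => //.
    (* Where [rho x > 0], the sequence is constant once [d_ n <= rho x]. *)
    apply: cvg_near_cst; have := rho0 x; rewrite le_eqVlt => /predU1P[<-|rx0].
      by apply: nearW => n; rewrite mul0r.
    exists (Num.trunc (rho x)^-1) => // i /= qi.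
    rewrite indicE mem_set ?mulr1// /A/= (le_trans (d_le _ _ qi))//.
    by rewrite /d_ invf_ple ?posrE// ltW// truncnS_gt.
  have rfin : (\int[mu]_x (rho x)%:E)%E \is a fin_num.
    by rewrite ge0_fin_numE//; apply: integral_ge0 => x _; rewrite lee_fin.
  have ud0 : 0 < u * d_ j * b by rewrite !mulr_gt0.
  apply: contrapT => h.
  have : (\int[mu]_x (rho x)%:E <= \int[mu]_x (rho x)%:E - (u * d_ j * b)%:E)%E.
    (* Only indices [n >= j] matter for the limit, and [j <= n] is what later puts [B j] inside
       [A n]. *)
    apply: (cvge_le _ cvr); exists j => // n jn.
    rewrite leeBrDr// ltW// ltNge; apply/negP => hn; apply: h.
    by exists n.
  by rewrite leNgt lteBlDr// lteDl// lte_fin ud0.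
have mA : measurable (A n) by exact: msup.
have mrA : measurable_fun setT (fun x => rho x * \1_(A n) x).
  by apply: measurable_funM.
have mtB (t : R) : measurable_fun setT (fun x => t * \1_(B j) x).
  by apply: measurable_funM.
have rA0 x : 0 <= rho x * \1_(A n) x by rewrite mulr_ge0.
have rA_le : (\int[mu]_x (rho x * \1_(A n) x)%:E <= \int[mu]_x (rho x)%:E)%E.
  apply: ge0_le_integral => //.
  - by move=> x _; rewrite lee_fin.
  - exact/measurable_EFinP.
  - exact/measurable_EFinP.
  - by move=> x _; rewrite lee_fin ler_piMr// indicE; case: (_ \in _).
have rfin : (\int[mu]_x (rho x)%:E)%E \is a fin_num.
  by rewrite ge0_fin_numE//; apply: integral_ge0 => x _; rewrite lee_fin.
have rAfin : (\int[mu]_x (rho x * \1_(A n) x)%:E)%E \is a fin_num.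
  rewrite ge0_fin_numE ?(le_lt_trans rA_le)//.
  by apply: integral_ge0 => x _; rewrite lee_fin.
have [M ME] : exists M, (\int[mu]_x (rho x)%:E = M%:E)%E.
  by exists (fine (\int[mu]_x (rho x)%:E)); rewrite fineK.
have [a aE] : exists a, (\int[mu]_x (rho x * \1_(A n) x)%:E = a%:E)%E.
  by exists (fine (\int[mu]_x (rho x * \1_(A n) x)%:E)); rewrite fineK.
move: rA_le tail; rewrite ME aE -EFinD !lee_fin => aM tail.
(* The mass [M - a] cut off outside [A n], spread evenly over [B j]. *)
pose t := (M - a) / b.
have t0 : 0 <= t by rewrite divr_ge0 ?(ltW b0)// subr_ge0.
have tu : t <= u * d_ j by rewrite ler_pdivrMr// lerBlDl.
(* On [B j] one has [t <= u * d_ j <= u * rho], hence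
   [sigma <= (1 + u) * rho], and [rho <= 1 - d_ j], hence [sigma <= 1]. *)
pose sigma x := rho x * \1_(A n) x + t * \1_(B j) x.
have sigma_int : (\int[mu]_x (sigma x)%:E = \int[mu]_x (rho x)%:E)%E.
  rewrite /sigma; under eq_integral do rewrite EFinD.
  rewrite ge0_integralD//; last 4 first.
  - by move=> x _; rewrite lee_fin.
  - exact/measurable_EFinP.
  - by move=> x _; rewrite lee_fin mulr_ge0.
  - exact/measurable_EFinP.
  under [X in (_ + X)%E]eq_integral do rewrite EFinM.
  rewrite ge0_integralZl//; last first.
    exact/measurable_EFinP/measurable_indic.
  have -> : (\int[mu]_x (\1_(B j) x)%:E = b%:E)%E.
    by rewrite integral_indic// setIT; exact: bE.
  rewrite -EFinM divfK ?gt_eqF//.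
  by rewrite aE ME -EFinD [(a + _)%R]addrC subrK.
have msigma : measurable_fun setT sigma by apply: measurable_funD.
have BA : B j `<=` A n by apply: subset_trans Bsup (A_nd _ _ jn).
have sigmaA : density_on (A n) sigma.
  split => // x; apply/andP; split.
    by rewrite addr_ge0// mulr_ge0.
  rewrite /sigma !indicE.
  have [Bx|nBx] := boolP (x \in B j).
    have Ax : x \in A n by move: Bx; rewrite !inE => /BA.
    rewrite Ax !mulr1; move: Bx; rewrite inE => -[_ /= rx].
    apply: (le_trans (lerD rx tu)).
    by rewrite -lerBrDl opprB addrC subrK ler_piMl// ltW.
  rewrite mulr0 addr0; case: (x \in A n); by rewrite ?mulr1 ?mulr0.
have sigma_le x : 0 <= sigma x <= (1 + u) * rho x.
  have /andP[-> _] := sigmaA.2 x; rewrite /= mulrDl mul1r lerD//.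
    by rewrite ler_piMr// indicE; case: (_ \in _).
  rewrite indicE; have [Bx|nBx] := boolP (x \in B j); last first.
    by rewrite mulr0 mulr_ge0// ltW.
  rewrite mulr1 (le_trans tu)// ler_pM2l//.
  by move: Bx; rewrite inE => /Bsup.
have sigma_energy : (interaction mu k sigma <= (I + e / 2)%:E)%E.
  apply: (@le_trans _ _ (((1 + u) ^+ 2)%:E * interaction mu k rho)%E).
    rewrite -interaction_scale//; last by rewrite addr_ge0// ltW.
    by apply: le_interaction => //; exact: measurable_funM.
  by rewrite IE -EFinM lee_fin.
(* On [A n] one has [1 <= (n + 1) * rho], so the finite energy of [rho] bounds that of
   [\1_(A n)]. *)
have A_energy : (interaction mu k \1_(A n) < +oo)%E.
  apply: (@le_lt_trans _ _ ((n.+1%:R ^+ 2)%:E * interaction mu k rho)%E).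
    rewrite -interaction_scale//; apply: le_interaction => //.
    - exact: measurable_funM.
    - move=> x; rewrite indicE ler0n/=.
      have [Ax|_] := boolP (x \in A n); last by rewrite mulr_ge0.
      by move: Ax; rewrite inE /A/= /d_ -ler_pdivrMl// mulr1.
  by rewrite IE -EFinM ltry.
have Afin : (mu (A n) < +oo)%E by exact: superlevel_set_finite.
have e20 : 0 < e / 2 by rewrite divr_gt0.
have [W [mW muW WI]] :=
  set_approx_density_on _ _ _ _ mA Afin sigmaA nk A_energy e20.
exists W; split => //; first by rewrite -ME -sigma_int; exact: muW.
apply: (le_trans WI).
rewrite IE [in leRHS](splitr e) [in leRHS]EFinD [leRHS]addeA.
by apply: leeD; rewrite -?EFinD.
Qed.

End set_approximation.

(** Whenever [f y = g y], the inner integrands agree for almost every [x]; such [y] are almost all.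
    This allows a density bounded only almost everywhere to be replaced by one bounded
    everywhere. *)
Lemma iterated_integral_ae_eq {disp : measure_display}
    {T : measurableType disp} {R : realType}
    (mu : {sigma_finite_measure set T -> \bar R}) (k : T * T -> \bar R)
    (f g : T -> R) :
  measurable_fun setT k -> measurable_fun setT f -> measurable_fun setT g ->
  {ae mu, forall x, f x = g x} ->
  (\int[mu]_y \int[mu]_x (k (x, y) * (f x)%:E * (f y)%:E) =
   \int[mu]_y \int[mu]_x (k (x, y) * (g x)%:E * (g y)%:E))%E.
Proof.
move=> mk mf mg fg.
have mkh (h : T -> R) : measurable_fun setT h ->
    measurable_fun setT (fun z : T * T => k z * (h z.1)%:E * (h z.2)%:E)%E.
  move=> mh; apply: emeasurable_funM; [apply: emeasurable_funM => //|].
  - by apply/measurable_EFinP; exact: measurableT_comp mh measurable_fst.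
  - by apply/measurable_EFinP; exact: measurableT_comp mh measurable_snd.
(* The densities may be negative on a null set, so that measurability of the
   inner integral is not covered by Tonelli's theorem directly. *)
have mI (h : T -> R) : measurable_fun setT h -> measurable_fun setT
    (fun y => \int[mu]_x (k (x, y) * (h x)%:E * (h y)%:E))%E.
  move=> /mkh mh; under eq_fun do rewrite integralE.
  apply: emeasurable_funB.
  - apply: eq_measurable_fun (measurable_fun_fubini_tonelli_G (m1 := mu) _
      (measurable_funepos mh) (fun=> funepos_ge0 _ _)) => y _.
    by apply: eq_integral => x _; rewrite !funeposE.
  - apply: eq_measurable_fun (measurable_fun_fubini_tonelli_G (m1 := mu) _
      (measurable_funeneg mh) (fun=> funeneg_ge0 _ _)) => y _.
    by apply: eq_integral => x _; rewrite !funenegE.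
apply: ae_eq_integral => //; [exact: mI|exact: mI|].
apply: filterS (fg) => y fgy _; rewrite fgy.
apply: ae_eq_integral => //.
- apply: emeasurable_funM => //; apply: emeasurable_funM.
    exact: measurable_fun_pair1.
  exact/measurable_EFinP.
- apply: emeasurable_funM => //; apply: emeasurable_funM.
    exact: measurable_fun_pair1.
  exact/measurable_EFinP.
- by apply: filterS fg => x -> _.
Qed.

(** * The relaxed problem *)

Section densities.
Context {R : realType} {d : nat}.
Local Notation mu := (@lebesgue_rV R d).
Implicit Types (K : 'rV[R]_d -> \bar R) (m : R).

Lemma nonneg_kernel_sub K : lower_semicontinuous K ->
  (forall x, (0 <= K x)%E) ->
  nonneg_kernel (fun z : Rd R d * Rd R d => K (z.1 - z.2)).
Proof. by move=> lscK K0; split => // ; exact: measurable_lsc_sub. Qed.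

Lemma energyE K (f : Rd R d -> R) : lower_semicontinuous K ->
  (forall x, (0 <= K x)%E) -> measurable_fun setT f -> (forall x, 0 <= f x) ->
  energy K f = interaction mu (fun z => K (z.1 - z.2)) f.
Proof.
move=> lscK K0 mf f0; rewrite interaction_iterated//.
exact: nonneg_kernel_sub.
Qed.

(** The convention [+oo * 0 = 0] removes the points outside [Omega] even where [K] is infinite. *)
Lemma energy_indic K (Omega : set (Rd R d)) :
  energy K \1_Omega = set_energy K Omega.
Proof.
rewrite /set_energy /energy [RHS]integral_mkcond; apply: eq_integral => y _.
rewrite patchE; case: ifPn => yO; last first.
  under eq_integral do rewrite [\1_Omega y]indicE (negbTE yO) mule0.
  by rewrite integral0.
rewrite [RHS]integral_mkcond; apply: eq_integral => x _.
rewrite patchE !indicE yO mule1; case: ifPn => _; first by rewrite mule1.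
by rewrite mule0.
Qed.

Lemma admissible_indic m (Omega : set (Rd R d)) :
  admissible_sets m Omega -> admissible_densities m (\1_Omega : Rd R d -> R).
Proof.
move=> [mO muO].
have N1 : ('N[mu]_1[EFin \o (\1_Omega : Rd R d -> R)] = m%:E)%E.
  rewrite Lnorm1 -muO -[in RHS](setIT Omega) -integral_indic//.
  by apply: eq_integral => x _ /=; rewrite ger0_norm.
have mind : (\1_Omega : Rd R d -> R) \in mfun.
  by rewrite inE; exact: measurable_indic.
split => //.
- by apply/andP; split => //; rewrite inE /= /finite_norm N1 ltry.
- apply/andP; split => //; rewrite inE /= /finite_norm unlock /=.
  case: ifPn => _; last exact: ltry.
  apply: (@le_lt_trans _ _ 1%E); last exact: ltry.
  apply/ess_supP; apply: nearW => x /=.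
  by rewrite lee_fin ger0_norm// indicE lern1 leq_b1.
- by apply: nearW => x; rewrite indicE; case: (_ \in _); rewrite lexx ler01.
Qed.

Lemma inf_set_energy_le K m (rho : Rd R d -> R) : (0 < d)%N ->
  lower_semicontinuous K -> (forall x, (0 <= K x)%E) ->
  admissible_densities m rho ->
  (ereal_inf [set set_energy K Omega | Omega in admissible_sets m] <=
   energy K rho)%E.
Proof.
move=> d0 lscK K0 [rhoL1 _ rhom rho01].
(* Truncation makes the bounds hold at every point and changes [rho] only on a null set. *)
pose f x := Num.max 0 (Num.min 1 (rho x)).
have mrho : measurable_fun setT rho by move: rhoL1 => /andP[]; rewrite inE.
have mf : measurable_fun setT f.
  by apply: measurable_maxr => //; exact: measurable_minr.
have f01 x : 0 <= f x <= 1.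
  by rewrite le_max lexx/= ge_max ler01/= ge_min lexx.
have f0 x : 0 <= f x by have /andP[] := f01 x.
have rhof : {ae mu, forall x, rho x = f x}.
  apply: filterS rho01 => x /andP[r0 r1].
  by rewrite /f (min_idPr r1) (max_idPr r0).
have intf : (\int[mu]_x (f x)%:E)%E = m%:E.
  rewrite -rhom Lnorm1; apply: ge0_ae_eq_integral => //.
  - exact/measurable_EFinP.
  - by apply: measurableT_comp => //; exact/measurable_EFinP.
  - by move=> x _; rewrite lee_fin.
  - by apply: filterS rhof => x /= -> _; rewrite ger0_norm.
have nK := nonneg_kernel_sub _ lscK K0.
have -> : energy K rho = energy K f.
  by have := iterated_integral_ae_eq mu _ _ _ nK.1 mrho mf rhof.
rewrite energyE//.
(* Approximation by sets requires finite energy; for infinite energy the bound is trivial. *)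
have [->|kfin] := eqVneq (interaction mu (fun z => K (z.1 - z.2)) f) +oo%E.
  exact: leey.
rewrite -ltey in kfin.
apply/lee_addgt0Pr => e e0.
have intffin : (\int[mu]_x (f x)%:E < +oo)%E by rewrite intf ltry.
have [W [mW muW We]] := set_approx_density _ (nonatomic_lebesgue_rV d0)
  _ _ _ mf f01 intffin nK kfin e0.
apply: le_trans We; apply: ereal_inf_lbound; exists W.
  by split => //; rewrite -intf.
by rewrite -energy_indic energyE//; exact: measurable_indic.
Qed.

End densities.

Theorem theorem4p4 (R : realType) (d : nat) (m : R) (K : 'rV[R]_d -> \bar R)
  (d_ge2 : (2 <= d)%N) (m_gt0 : 0 < m)
  (K_radial : radially_symmetric K)
  (K_locint : locally_integrable_rV K)
  (K_ge0 : forall x, (0 <= K x)%E)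
  (K_lsc : lower_semicontinuous K)
  (K_infty : tends_to_infinity K)
  (Omega : set (Rd R d)) (mOmega : measurable Omega)
  (Omega_m : lebesgue_rV Omega = m%:E) :
  solution (admissible_sets m) (set_energy K) Omega <->
  solution (admissible_densities m) (energy K) (\1_Omega : Rd R d -> R).
Proof.
have d_gt0 : (0 < d)%N by exact: leq_trans d_ge2.
(* Once the infima coincide, both sides of the equivalence assert the same equation, because
   [\1_Omega] and [Omega] have the same energy. *)
have inf_eq : ereal_inf [set set_energy K W | W in admissible_sets m] =
    ereal_inf [set energy K rho | rho in admissible_densities m].
  apply/eqP; rewrite eq_le; apply/andP; split.
    by apply: le_ereal_inf_tmp => _ [rho rhom <-]; exact: inf_set_energy_le.
  apply: ereal_inf_le_tmp => _ [W Wm <-].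
  by exists \1_W; [exact: admissible_indic|exact: energy_indic].
rewrite /solution energy_indic inf_eq.
by split => -[_ ->]; split => //; exact: admissible_indic.
Qed.
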